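(* Let $(X,\mathcal{A},d)$ be a $C^*$-algebra valued metric space and let $T:X\to X$ be a $C^*$-algebra valued contraction, with $A\in\mathcal{A}$ such that $\|A\|<1$ and $d(Tx,Ty)\leq A^*d(x,y)A$ for every $x,y\in X$. Then for all $x_1,x_2\in X$, $$\|d(x_1,x_2)\|\leq \frac{1}{1-\|A\|^2}\,\|d(x_1,T(x_1))+d(T(x_2),x_2)\|.$$
   Context: Let $X$ be a nonempty set and $\mathcal{A}$ a unital $C^*$-algebra with norm $\|\cdot\|$; $\leq$ denotes the usual order on self-adjoint elements of $\mathcal{A}$ ($a\le b$ iff $b-a$ is positive). A function $d:X\times X\to\mathcal{A}$ is a $C^*$-algebra valued metric on $X$ if: (a) $d(x,y)\geq 0$ for all $x,y\in X$, and $d(x,y)=0\Leftrightarrow x=y$; (b) $d(x,y)=d(y,x)$ for all $x,y\in X$; (c) $d(x,y)\leq d(x,z)+d(z,y)$ for all $x,y,z\in X$. Then $(X,\mathcal{A},d)$ is called a $C^*$-algebra valued metric space. A function $T:X\to X$ is a $C^*$-algebra valued contraction if there exists $A\in\mathcal{A}$ with $\|A\|<1$ and $d(Tx,Ty)\leq A^*d(x,y)A$ for every $x,y\in X$. *)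

(* Defs.v *)
From HB Require Import structures.
From mathcomp Require Import all_boot all_order all_algebra.
From mathcomp Require Import complex.
From mathcomp Require Import all_classical all_reals all_analysis.

Set Implicit Arguments.
Unset Strict Implicit.
Unset Printing Implicit Defensive.

Import Order.TTheory GRing.Theory Num.Theory.
Import numFieldNormedType.Exports.

Local Open Scope ring_scope.

(* The scalars are the complex numbers R[i] over R : realType, so the norm of a
   normedModType R[i] takes its values in R[i].  Since (x <= y) in R[i] means
   that y - x is a nonnegative real, these norms are nonnegative reals and
   inequalities between them are the usual ones.

   MathComp has no join of its normed and ring structures apart from
   numDomainType, so the multiplication is introduced by this mixin and the ring
   instance is derived from it below.  The ring is a pzRingType, not an algType:
   1 != 0 is not imposed, so the zero algebra is allowed. *)
HB.mixin Record isCstarAlgebra (R : realType) A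
    of CompleteNormedModule R[i] A := {
  cstar_one : A ;
  cstar_mul : A -> A -> A ;
  cstar_mulA : associative cstar_mul ;
  cstar_mul1l : left_id cstar_one cstar_mul ;
  cstar_mul1r : right_id cstar_one cstar_mul ;
  cstar_mulDl : left_distributive cstar_mul +%R ;
  cstar_mulDr : right_distributive cstar_mul +%R ;
  cstar_scaleAl : forall (k : R[i]) (x y : A),
    k *: cstar_mul x y = cstar_mul (k *: x) y ;
  cstar_scaleAr : forall (k : R[i]) (x y : A),
    k *: cstar_mul x y = cstar_mul x (k *: y) ;
  cstar_normM : forall x y : A, `|cstar_mul x y| <= `|x| * `|y| ;
  star : A -> A ;
  starK : involutive star ;
  starD : {morph star : x y / x + y} ;
  starZ : forall (k : R[i]) (x : A), star (k *: x) = k^* *: star x ;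
  starM : forall x y : A,
    star (cstar_mul x y) = cstar_mul (star y) (star x) ;
  cstar_identity : forall x : A, `|cstar_mul (star x) x| = `|x| ^+ 2
}.

#[short(type="cstarAlgType")]
HB.structure Definition CstarAlgebra (R : realType) :=
  {A of CompleteNormedModule R[i] A & isCstarAlgebra R A}.

#[non_forgetful_inheritance]
HB.instance Definition _ (R : realType) (A : cstarAlgType R) :=
  GRing.Zmodule_isPzRing.Build (CstarAlgebra.sort A)
    (@cstar_mulA R A) (@cstar_mul1l R A) (@cstar_mul1r R A)
    (@cstar_mulDl R A) (@cstar_mulDr R A).

Section CstarOrder.
Variables (R : realType) (A : cstarAlgType R).
Implicit Types (a b : A) (k : R[i]).

Definition self_adjoint a : Prop := star a = a.

Definition invertible a : Prop := exists b, a * b = 1 /\ b * a = 1.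

Definition spectrum a : set R[i] := [set k : R[i] | ~ invertible (k *: (1 : A) - a)]%classic.

(* 0 <= k in R[i] says that k is real and nonnegative. *)
Definition cstar_positive a : Prop :=
  self_adjoint a /\ (forall k, spectrum a k -> 0 <= k).

Definition cstar_le a b : Prop := cstar_positive (b - a).

End CstarOrder.

Record cstar_metric (R : realType) (A : cstarAlgType R) (X : Type)
    (d : X -> X -> A) : Prop := CstarMetric {
  cstar_metric_ge0 : forall x y, cstar_le 0 (d x y) ;
  cstar_metric_eq0 : forall x y, d x y = 0 <-> x = y ;
  cstar_metric_sym : forall x y, d x y = d y x ;
  cstar_metric_triangle : forall x y z, cstar_le (d x y) (d x z + d z y)
}.

(* Main.v *)
(* From d(x1,x2) <= d(x1,Tx1) + d(Tx1,Tx2) + d(Tx2,x2) <= S + a^* d(x1,x2) a, with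
   S = d(x1,Tx1) + d(Tx2,x2), the bound follows from monotonicity of the norm on
   positive elements.  For that monotonicity, and for sums of positive elements,
   one needs that norm and spectral radius agree on a self-adjoint x.  This is
   obtained without complex analysis: if |b| = 1 and h = b^2 / (1 - b^2) exists,
   the same quotient for b^2 has norm at most |h| / 2, while every such quotient
   has norm at least 1/2; iterating b -> b^2 gives a contradiction. *)

Require Import Defs.
From HB Require Import structures.
From mathcomp Require Import all_boot all_order all_algebra.
From mathcomp Require Import complex.
From mathcomp Require Import all_classical all_reals all_analysis.

Import Order.TTheory GRing.Theory Num.Theory.
Import numFieldNormedType.Exports.

Local Open Scope ring_scope.

(** Being comparable with [0], both [r] and [e] are real, so the decay of powers in [R] applies. *)
Lemma complex_expr_lt (R : realType) (r e : R[i]) :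
  0 <= r -> r < 1 -> 0 < e -> exists N, r ^+ N < e.
Proof.
move=> r0 r1 e0.
have [s rE] : exists s : R, r = (s%:C)%C.
  by exists (complex.Re r); rewrite RRe_real // ger0_real.
have [t eE] : exists t : R, e = (t%:C)%C.
  by exists (complex.Re e); rewrite RRe_real // gtr0_real.
subst r e.
move: r0 r1 e0; rewrite -[0]/((0 : R)%:C)%C -[1]/((1 : R)%:C)%C lecR !ltcR.
move=> s0 s1 t0.
have s1' : `|s| < 1 by rewrite ger0_norm.
have /cvgrPdist_lt/(_ _ t0)[N _ /(_ N (leqnn N))] := cvg_expr s1'.
rewrite sub0r normrN ger0_norm ?exprn_ge0// => sN.
by exists N; rewrite -rmorphXn ltcR.
Qed.

Section CstarAlgebraTheory.
Set Implicit Arguments.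
Unset Strict Implicit.
Unset Printing Implicit Defensive.
Variables (R : realType) (A : cstarAlgType R).
Implicit Types (x y z b h p q : A) (k t : R[i]).

(** * Norm, unit and involution *)

Lemma cstar_scalerAl k x y : k *: (x * y) = k *: x * y.
Proof. exact: cstar_scaleAl. Qed.

Lemma cstar_scalerAr k x y : k *: (x * y) = x * (k *: y).
Proof. exact: cstar_scaleAr. Qed.

Lemma cstar_ler_normM x y : `|x * y| <= `|x| * `|y|.
Proof. exact: cstar_normM. Qed.

Lemma star_mulr x y : star (x * y) = star y * star x.
Proof. exact: starM. Qed.

Lemma star_add x y : star (x + y) = star x + star y.
Proof. exact: starD. Qed.

Lemma norm_star_mul x : `|star x * x| = `|x| ^+ 2.
Proof. exact: cstar_identity. Qed.

Lemma star1 : star 1 = 1 :> A.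
Proof. by rewrite -[LHS]mulr1 -[LHS]starK star_mulr starK mulr1 starK. Qed.

Lemma star_opp x : star (- x) = - star x.
Proof. by rewrite -[in LHS]scaleN1r starZ rmorphN1 scaleN1r. Qed.

Lemma norm_star x : `|star x| = `|x|.
Proof.
have le y : `|y| <= `|star y|.
  have [->|y0] := eqVneq y 0; first by rewrite normr0.
  by rewrite -(ler_pM2r (_ : 0 < `|y|)) ?normr_gt0// -expr2 -norm_star_mul
     cstar_ler_normM.
by apply/le_anti; rewrite le andbT -{2}(starK x) le.
Qed.

(** The C*-identity at [1] makes the norm of [1] idempotent, hence 0 or 1; the value 0 occurs in the
    zero algebra. *)
Lemma cstar_norm1_le1 : `|1 : A| <= 1.
Proof.
have := norm_star_mul 1; rewrite star1 mulr1 expr2 => n1.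
have [n0|n0] := eqVneq `|1 : A| 0; first by rewrite n0.
by rewrite -(mulfI n0 (etrans (mulr1 _) n1)).
Qed.

Lemma cstar_ler_normX x n : `|x ^+ n| <= `|x| ^+ n.
Proof.
elim: n => [|n IH]; first exact: cstar_norm1_le1.
by rewrite !exprS (le_trans (cstar_ler_normM _ _))// ler_wpM2l.
Qed.

(** * Invertible elements and the Neumann series *)

Lemma invertible_mul x y : invertible x -> invertible y -> invertible (x * y).
Proof.
move=> [u [xu ux]] [v [yv vy]]; exists (v * u); split.
  by rewrite mulrA -(mulrA x) yv mulr1.
by rewrite mulrA -(mulrA v) ux mulr1.
Qed.

Lemma invertible_star x : invertible x -> invertible (star x).
Proof.
by move=> [u [xu ux]]; exists (star u); rewrite -!star_mulr xu ux star1.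
Qed.

Lemma invertible_scale k x : k != 0 -> invertible x -> invertible (k *: x).
Proof.
move=> k0 [u [xu ux]]; exists (k^-1 *: u).
by rewrite -!cstar_scalerAl -!cstar_scalerAr !scalerA mulfV// mulVf// !scale1r xu ux.
Qed.

Lemma geometric_le (r : R[i]) n :
  0 <= r -> r < 1 -> \sum_(i < n) r ^+ i <= (1 - r)^-1.
Proof.
move=> r0 r1; rewrite -[leRHS]mul1r ler_pdivlMr ?subr_gt0// mulrC.
have -> : (1 - r) * \sum_(i < n) r ^+ i = 1 - r ^+ n.
  by rewrite -[in LHS]opprB mulNr -subrX1 opprB.
by rewrite gerBl exprn_ge0.
Qed.

Lemma norm_geometric_le x n :
  `|x| < 1 -> `|\sum_(i < n) x ^+ i| <= (1 - `|x|)^-1.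
Proof.
move=> x1; apply: le_trans _ (geometric_le n (normr_ge0 x) x1).
by apply: le_trans (ler_norm_sum _ _ _) _; apply: ler_sum => i _; exact: cstar_ler_normX.
Qed.

Lemma geometric_cvg x : `|x| < 1 ->
  cvg ((fun n => \sum_(i < n) x ^+ i) @ \oo)%classic.
Proof.
move=> x1; apply: cauchy_cvg; apply: cauchy_exP => e e0.
have d0 : 0 < 1 - `|x| by rewrite subr_gt0.
have [N xN] := @complex_expr_lt R `|x| _ (normr_ge0 x) x1 (mulr_gt0 e0 d0).
exists (\sum_(i < N) x ^+ i); exists N => // n /= Nn.
rewrite -ball_normE /ball_ /= -normrN opprB.
have tail m : \sum_(i < N + m) x ^+ i - \sum_(i < N) x ^+ i
    = x ^+ N * \sum_(i < m) x ^+ i.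
  rewrite big_split_ord /= addrAC subrr add0r mulr_sumr.
  by apply: eq_bigr => i _; rewrite exprD.
have := tail (n - N)%N; rewrite subnKC// => ->.
apply: le_lt_trans (cstar_ler_normM _ _) _.
apply: le_lt_trans (_ : `|x| ^+ N * (1 - `|x|)^-1 < e).
  by apply: ler_pM; rewrite ?cstar_ler_normX ?norm_geometric_le.
by rewrite ltr_pdivrMr.
Qed.

Lemma invertible_one_sub x : `|x| < 1 -> invertible (1 - x).
Proof.
move=> x1; pose S n := \sum_(i < n) x ^+ i.
have /cvg_ex[L SL] := geometric_cvg x1.
have SE n : (1 - x) * S n = 1 - x ^+ n.
  by rewrite -[in LHS]opprB mulNr -subrX1 opprB.
have SE' n : S n * (1 - x) = 1 - x ^+ n.
  rewrite -SE; apply/esym/commr_sym/commrB; first exact: commr1.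
  by apply/commr_sym/commr_sum => i _; exact: commrX.
(* Left and right multiplication by [1 - x] are both Lipschitz, so one limit argument gives both
   halves of the inverse: [f L - 1] splits at [f (S n)] into a Lipschitz term and a power of [x],
   each at most [c / 2]. *)
have small (f : A -> A) : (forall n, f (S n) = 1 - x ^+ n) ->
    (forall y z, `|f y - f z| <= `|1 - x| * `|y - z|) -> f L = 1.
  move=> fS fl; apply/eqP; rewrite -subr_eq0 -normr_eq0; apply/negPn/negP => c0.
  set c := `|_| in c0.
  have c_gt0 : 0 < c by rewrite lt_def c0 normr_ge0.
  (* The [+ 1] keeps the divisor positive even when [1 - x] has norm 0. *)
  have D0 : 0 < `|1 - x| + 1 by rewrite ltr_wpDl.
  have c2 : 0 < c / 2 by rewrite divr_gt0.
  have [N xN] := @complex_expr_lt R `|x| _ (normr_ge0 x) x1 c2.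
  have /cvgrPdist_lt/(_ _ (divr_gt0 c2 D0))[M _ LM] := SL.
  have := LM (maxn M N) (leq_maxl _ _).
  rewrite ltr_pdivlMr// => /= LS.
  have : c < c / 2 + c / 2.
    rewrite {1}/c -(subrK (f (S (maxn M N))) (f L)) -addrA fS.
    apply: le_lt_trans (ler_normD _ _) _; apply: ltr_leD.
      rewrite -fS; apply: le_lt_trans (fl _ _) _; apply: le_lt_trans _ LS.
      by rewrite mulrC ler_wpM2l// lerDl.
    rewrite [_ - _ - _]addrAC subrr sub0r normrN.
    apply: le_trans (cstar_ler_normX _ _) _; apply: le_trans _ (ltW xN).
    by rewrite ler_wiXn2l ?leq_maxr// ltW.
  by rewrite -splitr ltxx.
exists L; split.
- apply: (small (fun y => (1 - x) * y)) => // y z.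
  by rewrite -mulrBr cstar_ler_normM.
- apply: (small (fun y => y * (1 - x))) => // y z.
  by rewrite -mulrBl mulrC cstar_ler_normM.
Qed.

Lemma invertible_scalar_sub k x : `|x| < `|k| -> invertible (k *: (1 : A) - x).
Proof.
move=> xk.
have k0 : k != 0 by rewrite -normr_gt0 (le_lt_trans _ xk).
have -> : k *: (1 : A) - x = k *: (1 - k^-1 *: x) by rewrite scalerBr scalerA mulfV// scale1r.
apply: invertible_scale => //; apply: invertible_one_sub.
by rewrite normrZ normfV mulrC ltr_pdivrMr ?normr_gt0// mul1r.
Qed.

(** * Self-adjoint elements: norm against spectrum *)

Lemma norm_self_adjointM x : self_adjoint x -> `|x * x| = `|x| ^+ 2.
Proof. by move=> xx; rewrite -norm_star_mul xx. Qed.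

Lemma star_cartesian p q : self_adjoint p -> self_adjoint q ->
  star (p + 'i *: q) = p - 'i *: q.
Proof. by move=> pp qq; rewrite star_add starZ pp qq conjCi scaleNr. Qed.

Lemma cartesian_mul p q : p * q = q * p ->
  (p - 'i *: q) * (p + 'i *: q) = p * p + q * q.
Proof.
move=> pq; have ii : 'i * 'i = -1 :> R[i] by rewrite -expr2 sqrCi.
rewrite mulrDr !mulrDl !mulNr -!cstar_scalerAl -!cstar_scalerAr scalerA.
by rewrite ii scaleN1r opprK pq -addrA addKr.
Qed.

Lemma norm_cartesian p q : self_adjoint p -> self_adjoint q -> p * q = q * p ->
  `|p + 'i *: q| ^+ 2 = `|p * p + q * q|.
Proof. by move=> pp qq pq; rewrite -norm_star_mul star_cartesian// cartesian_mul. Qed.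

(** [p] is the real part of [w = p + 'i *: q], so its norm is at most that of [w], whose square is
    the right-hand side. No order on [A] enters. *)
Lemma norm_sum_sq_ge p q : self_adjoint p -> self_adjoint q -> p * q = q * p ->
  `|p| ^+ 2 <= `|p * p + q * q|.
Proof.
move=> pp qq pq; rewrite -norm_cartesian// lerXn2r ?nnegrE//.
set w := p + _.
have : `|w + star w| <= `|w| + `|w| by rewrite (le_trans (ler_normD _ _))// norm_star.
rewrite star_cartesian// addrACA subrr addr0 -!mulr2n normrMn.
by rewrite lerMn2r.
Qed.

(** Factor [1 + b * b] as [(1 - 'i *: b) * (1 + 'i *: b)]. The first factor is 2 minus the second,
    whose squared norm is at most 2 < 4, so it is invertible; the second is its adjoint. *)
Lemma invertible_one_add_sq b : self_adjoint b -> `|b| <= 1 ->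
  invertible (1 + b * b).
Proof.
move=> bb b1.
have s1 : self_adjoint (1 : A) := star1.
have c1 : 1 * b = b * 1 by rewrite mul1r mulr1.
have w2 : `|1 + 'i *: b| < `|2 : R[i]|.
  rewrite (@ger0_norm _ 2)// -(@ltr_pXn2r _ 2)// ?nnegrE// norm_cartesian// mulr1.
  apply: (@le_lt_trans _ _ (1 + 1)); last by rewrite -natrX -[1 + 1]/(2%:R) ltr_nat.
  apply: le_trans (ler_normD _ _) _; apply: lerD; first exact: cstar_norm1_le1.
  by rewrite norm_self_adjointM// exprn_ile1.
have inv1 : invertible (1 - 'i *: b).
  have := invertible_scalar_sub w2.
  by rewrite scaler_nat mulr2n opprD addrA addrK.
rewrite -{1}[1]mulr1 -cartesian_mul//; apply: invertible_mul => //.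
by rewrite -[X in invertible X]starK star_cartesian//; exact: invertible_star.
Qed.

(* With k = b^2 / (1 + b^2), h k plays the role of b^4 / (1 - b^4), and
   c = b / (1 + b^2) satisfies (2c)^2 + (1 - 2k)^2 = 1, so that |k| <= 1/2. *)
Lemma halving_step b h : self_adjoint b -> `|b| = 1 ->
  h * (1 - b * b) = b * b ->
  exists2 h', h' * (1 - b * b * (b * b)) = b * b * (b * b) & `|h'| *+ 2 <= `|h|.
Proof.
move=> bb b1 hb.
have [z [bz zb]] : invertible (1 + b * b) by apply: invertible_one_add_sq; rewrite ?b1.
have cb : b * (1 + b * b) = (1 + b * b) * b by rewrite mulrDr mulrDl mulr1 mul1r mulrA.
have bzC : b * z = z * b.
  by rewrite -[LHS]mul1r -zb -mulrA (mulrA _ b) -cb -(mulrA b) bz mulr1.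
have zz : star z = z.
  rewrite -[LHS]mulr1 -bz mulrA.
  have -> : star z * (1 + b * b) = star ((1 + b * b) * z).
    by rewrite star_mulr star_add star1 star_mulr bb.
  by rewrite bz star1 mul1r.
pose c := b * z; pose k := b * c.
have cc : self_adjoint c by rewrite /self_adjoint star_mulr bb zz.
have cbC : b * c = c * b by rewrite /c -[RHS]mulrA -bzC.
have kk : self_adjoint k by rewrite /self_adjoint star_mulr bb cc.
have ckC : c * k = k * c by rewrite /k mulrA -cbC.
(* The left side is [(1 + b * b) * (c * c)], and [(1 + b * b) * c = b]. *)
have ck : c ^+ 2 + k ^+ 2 = k.
  have bcc : (1 + b * b) * c = b by rewrite /c mulrA -cb -mulrA bz mulr1.
  have -> : k ^+ 2 = b * b * (c * c) by rewrite expr2 /k -mulrA (mulrA c) -cbC -(mulrA b c c) mulrA.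
  by rewrite expr2 -{1}[c * c]mul1r -mulrDl mulrA bcc.
have sq1 : (c *+ 2) * (c *+ 2) + (k *+ 2 - 1) * (k *+ 2 - 1) = 1.
  rewrite -!expr2 sqrrB1 !exprMn_n addrA addrA -mulrnDl ck -mulrnA.
  by rewrite subrr add0r.
have c2 : `|c| *+ 2 <= 1.
  rewrite -normrMn -(@ler_pXn2r _ 2)// ?nnegrE// expr1n.
  apply: le_trans _ cstar_norm1_le1; rewrite -sq1.
  apply: norm_sum_sq_ge.
  - by rewrite /self_adjoint mulr2n star_add cc.
  - by rewrite /self_adjoint star_add star_opp star1 mulr2n star_add kk.
  - by rewrite mulrBr mulrBl mulr1 mul1r !mulrnAl !mulrnAr ckC.
(* Multiply [h * (1 - b * b) = b * b] by [k * (1 + b * b) = b * b]; all factors built from [b]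
   commute. *)
exists (h * k).
  have -> : 1 - b * b * (b * b) = (1 + b * b) * (1 - b * b).
    by rewrite mulrDl !mulrBr !mulr1 mul1r addrA subrK.
  have -> : k = b * b * z by rewrite /k /c mulrA.
  rewrite -(mulrA h) -(mulrA (b * b) z) (mulrA z) zb mul1r.
  have -> : b * b * (1 - b * b) = (1 - b * b) * (b * b).
    by rewrite mulrBr mulrBl mulr1 mul1r.
  by rewrite (mulrA h) hb.
rewrite -mulr_natr.
have kc : `|k| <= `|c| by rewrite (le_trans (cstar_ler_normM _ _))// b1 mul1r.
apply: le_trans (_ : `|h| * `|c| * 2 <= _); last first.
  by rewrite -mulrA mulr_natr ler_piMr.
by rewrite ler_wpM2r// (le_trans (cstar_ler_normM _ _))// ler_wpM2l.
Qed.

Lemma halving_lower_bound n b h : self_adjoint b -> `|b| = 1 ->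
  h * (1 - b * b) = b * b -> (2 ^ n)%:R <= `|h| *+ 2.
Proof.
elim: n b h => [|n IH] b h bb b1 hb.
  have y1 : `|b * b| = 1 by rewrite norm_self_adjointM// b1 expr1n.
  rewrite expn0 -[1%:R]y1 -{1}hb (le_trans (cstar_ler_normM _ _))// -mulr_natr ler_wpM2l//.
  by rewrite (le_trans (ler_normB _ _))// y1 -natr1 lerD2r cstar_norm1_le1.
have [h' h'E h'h] := halving_step bb b1 hb.
have bb2 : self_adjoint (b * b) by rewrite /self_adjoint star_mulr bb.
have bb1 : `|b * b| = 1 by rewrite norm_self_adjointM// b1 expr1n.
rewrite expnS mulnC natrM mulr_natr lerMn2r /=.
by apply: le_trans (IH _ _ bb2 bb1 h'E) _.
Qed.

(** Invertibility of both factors of [1 - b * b] would produce the quotient [h], whose doubled norm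
    would exceed every power of 2. *)
Lemma norm1_not_both_invertible b : self_adjoint b -> `|b| = 1 ->
  invertible (1 - b) -> invertible (1 + b) -> False.
Proof.
move=> bb b1 im ip.
have [u [_ uE]] : invertible (1 - b * b).
  have -> : 1 - b * b = (1 + b) * (1 - b).
    by rewrite mulrDl !mulrBr !mulr1 mul1r addrA subrK.
  exact: invertible_mul.
have hE : (b * b * u) * (1 - b * b) = b * b by rewrite -mulrA uE mulr1.
have H n := halving_lower_bound n bb b1 hE.
set H0 := `|_| *+ 2 in H.
have H0_gt0 : 0 < H0 by apply: lt_le_trans _ (H 0); rewrite expn0.
have half : (2^-1 : R[i]) < 1 by rewrite invf_lt1// ltr1n.
have [||N] := @complex_expr_lt R 2^-1 H0^-1 _ half; rewrite ?invr_gt0 ?invr_ge0//.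
rewrite exprVn ltf_pV2 ?posrE ?exprn_gt0// -natrX.
by rewrite (le_gtF (H N)).
Qed.

(* A self-adjoint element has real spectrum, so this amounts to saying that its
   spectral radius equals its norm. *)
Lemma norm_not_both_invertible x : self_adjoint x -> 0 < `|x| ->
  invertible (`|x| *: (1 : A) - x) -> invertible (`|x| *: (1 : A) + x) -> False.
Proof.
move=> xx x0; set M := `|x| in x0 *.
have M0 : M != 0 by rewrite gt_eqF.
have Mr : M^-1^* = M^-1 by apply/CrealP; rewrite realV normr_real.
move=> im ip; apply: (@norm1_not_both_invertible (M^-1 *: x)).
- by rewrite /self_adjoint starZ Mr xx.
- by rewrite normrZ normfV normr_id mulVf.
- have -> : 1 - M^-1 *: x = M^-1 *: (M *: (1 : A) - x).
    by rewrite scalerBr scalerA mulVf// scale1r.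
  by apply: invertible_scale => //; rewrite invr_eq0.
- have -> : 1 + M^-1 *: x = M^-1 *: (M *: (1 : A) + x).
    by rewrite scalerDr scalerA mulVf// scale1r.
  by apply: invertible_scale => //; rewrite invr_eq0.
Qed.

(** * Positive elements and monotonicity of the norm *)

Lemma positive_invertible x t : cstar_positive x -> 0 < t ->
  invertible (t *: (1 : A) + x).
Proof.
move=> [_ spx] t0; apply: contrapT => ninv.
suff /spx : spectrum x (- t) by rewrite oppr_ge0 (lt_geF t0).
move=> inv; apply: ninv.
have -> : t *: (1 : A) + x = (- 1) *: ((- t) *: (1 : A) - x).
  by rewrite scalerBr scalerA mulrNN mul1r !scaleN1r opprK.
by apply: invertible_scale => //; rewrite oppr_eq0 oner_neq0.
Qed.

(** If [y = t *: 1 - x] had norm [N > t], then [N - y = (N - t) + x] would be invertible by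
    positivity and [N + y = (N + t) - x] by the Neumann series. *)
Lemma positive_norm_sub_le x t : cstar_positive x -> `|x| <= t ->
  `|t *: (1 : A) - x| <= t.
Proof.
move=> px xt.
have t0 : 0 <= t := le_trans (normr_ge0 x) xt.
have treal : t^* = t by apply/CrealP; exact: ger0_real.
rewrite real_leNgt ?normr_real ?ger0_real//; apply/negP => tN.
have N0 := le_lt_trans t0 tN.
apply: (norm_not_both_invertible _ N0).
- by rewrite /self_adjoint star_add starZ star1 treal star_opp px.1.
- by rewrite opprB addrCA addrC -scalerBl; apply: positive_invertible; rewrite ?subr_gt0.
- rewrite addrA -scalerDl; apply: invertible_scalar_sub.
  rewrite ger0_norm ?addr_ge0// (le_lt_trans xt)// ltr_wpDr//.
Qed.

(* [exists t, |t - w| <= t] is a weakening of positivity that is visibly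
   stable under sums. *)
Lemma norm_sub_le_add w1 w2 t1 t2 :
  `|t1 *: (1 : A) - w1| <= t1 -> `|t2 *: (1 : A) - w2| <= t2 ->
  `|(t1 + t2) *: (1 : A) - (w1 + w2)| <= t1 + t2.
Proof.
move=> h1 h2; rewrite scalerDl opprD addrACA.
by rewrite (le_trans (ler_normD _ _))// lerD.
Qed.

(** The hypothesis on [t] is the weak positivity of [y - x]. If [y] had smaller norm than [x], the
    Neumann series would invert [|x| - x], while positivity inverts [|x| + x]. *)
Lemma positive_norm_le x y t : cstar_positive x ->
  `|t *: (1 : A) - (y - x)| <= t -> `|x| <= `|y|.
Proof.
move=> px ht.
have t0 : 0 <= t := le_trans (normr_ge0 _) ht.
rewrite real_leNgt ?normr_real//; apply/negP => yx.
have x0 : 0 < `|x| by exact: le_lt_trans yx.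
apply: (norm_not_both_invertible px.1 x0); last exact: positive_invertible.
have -> : `|x| *: (1 : A) - x = (t + `|x|) *: (1 : A) - ((t *: (1 : A) - (y - x)) + y).
  by rewrite -addrA opprB subrK scalerDl opprD addrACA subrr add0r.
apply: invertible_scalar_sub; rewrite ger0_norm ?addr_ge0//.
by apply: le_lt_trans (ler_normD _ _) _; rewrite ler_ltD.
Qed.

End CstarAlgebraTheory.

Theorem mainTheorem1 (R : realType) (A : cstarAlgType R)
    (X : Type) (X_nonempty : inhabited X)
    (d : X -> X -> A) (d_metric : cstar_metric d)
    (T : X -> X) (a : A) (a_lt1 : `|a| < 1)
    (T_contraction :
       forall x y : X, cstar_le (d (T x) (T y)) (star a * d x y * a)) :
  forall x1 x2 : X,
    `|d x1 x2| <= 1 / (1 - `|a| ^+ 2) * `|d x1 (T x1) + d (T x2) x2|.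
Proof.
move=> x1 x2; set S := d x1 (T x1) + _.
have D0 : 0 < 1 - `|a| ^+ 2 by rewrite subr_gt0 expr_lt1.
rewrite mulrAC mul1r ler_pdivlMr// mulrBr mulr1 lerBlDr.
have px : cstar_positive (d x1 x2).
  by have := cstar_metric_ge0 d_metric x1 x2; rewrite /cstar_le subr0.
(* Three positive differences: the triangle inequality through [T x1], then through [T x2], and the
   contraction. Their sum telescopes to [S + star a * d x1 x2 * a - d x1 x2]; [t] is the sum of
   their norms. *)
have h1 := positive_norm_sub_le (cstar_metric_triangle d_metric x1 x2 (T x1)) (lexx _).
have h2 := positive_norm_sub_le (cstar_metric_triangle d_metric (T x1) x2 (T x2)) (lexx _).
have h3 := positive_norm_sub_le (T_contraction x1 x2) (lexx _).
have h := norm_sub_le_add (norm_sub_le_add h1 h2) h3.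
apply: le_trans (_ : `|S + star a * d x1 x2 * a| <= _).
  apply: (positive_norm_le px); move: h.
  rewrite (_ : d x1 (T x1) + _ - _ + _ + _ = S + star a * d x1 x2 * a - d x1 x2); first exact.
  rewrite /S; move: (d x1 (T x1)) (d (T x1) x2) (d x1 x2) => p q x.
  move: (d (T x1) (T x2)) (d (T x2) x2) (star a * x * a) => r s v.
  rewrite -!addrA; congr (p + _).
  rewrite (addrCA q) (addrCA q r) (addrCA q s) addNKr.
  by rewrite (addrCA r s) (addrCA r v) subrr addr0 addrC -addrA.
apply: le_trans (ler_normD _ _) _; rewrite lerD2l.
apply: le_trans (cstar_ler_normM _ _) _; rewrite expr2 mulrA ler_wpM2r//.
by rewrite (le_trans (cstar_ler_normM _ _))// norm_star mulrC.
Qed.
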